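(* Let $\phi(t)=(q(t),p(t))$ be a Kepler orbit with energy $H>0$, eccentricity $e>1$ and periapsis at $t=0$, and write $S_+(\phi(t))=(r(t),s(t),\sqrt{2H})$. Then, with $\theta(t)$ the function determined by $\theta(0)=0$ and $\dot\theta(t)=-\dfrac{\sqrt{2H}}{|q(t)|}$, $$r(t)=\cosh\theta(t)\,r(0)+\sinh\theta(t)\,s(0),\qquad s(t)=\sinh\theta(t)\,r(0)+\cosh\theta(t)\,s(0).$$ Moreover $\theta(t)=-\psi_h(t)$ for all $t$, where $\psi_h(t)$ is the hyperbolic anomaly of $\phi(t)$.
   Context: The Kepler Hamiltonian is $H(q,p)=\frac12|p|^2-|q|^{-1}$ on $\{(q,p)\in\mathbb R^3\times\mathbb R^3: q\ne0\}$; a Kepler orbit is a solution of $\dot q=p$, $\dot p=-q/|q|^3$. On $\{(q,p): q\ne0,\ H(q,p)>0\}$ define $S_+(q,p)=[(r_0,\bar r),(s_0,\bar s),\sqrt{2H}]$, with $r=(r_0,\bar r),\ s=(s_0,\bar s)\in\mathbb R^{4}$ given by $$r_0=|p|^2|q|-1,\quad \bar r=-\sqrt{2H}\,|q|\,p,\quad s_0=-\sqrt{2H}\,\langle q,p\rangle,\quad \bar s=-\Big(\frac{q}{|q|}-\langle q,p\rangle p\Big).$$ For a hyperbolic orbit with $|a|=\frac1{2H}$, eccentricity $e>1$ and periapsis at $t=0$, the hyperbolic anomaly $\psi_h(t)$ (continuous, $\psi_h(0)=0$) and hyperbolic mean anomaly $M_h(t)$ satisfy $|q|=|a|(e\cosh\psi_h-1)$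 and $M_h=e\sinh\psi_h-\psi_h=|a|^{-3/2}t$. *)

(* Defs.v *)
From HB Require Import structures.
From mathcomp Require Import all_boot all_order all_algebra.
From mathcomp Require Import all_classical all_reals all_analysis.

Set Implicit Arguments.
Unset Strict Implicit.
Unset Printing Implicit Defensive.

Import Order.TTheory GRing.Theory Num.Theory.
Import numFieldNormedType.Exports.

Local Open Scope classical_set_scope.
Local Open Scope ring_scope.

Definition cosh (R : realType) (x : R) : R := (expR x + expR (- x)) / 2.

Definition sinh (R : realType) (x : R) : R := (expR x - expR (- x)) / 2.

Definition dot (R : realType) (n : nat) (u v : 'rV[R]_n) : R :=
  \sum_(i < n) u 0 i * v 0 i.

(* The library norm `|u| on matrices is the sup norm, hence this definition. *)
Definition enorm (R : realType) (n : nat) (u : 'rV[R]_n) : R :=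
  Num.sqrt (dot u u).

(* Indices are taken in Z/3Z: i + 1 and i + 2 are the cyclic successors of i. *)
Definition cross (R : realType) (u v : 'rV[R]_3) : 'rV[R]_3 :=
  \row_(i < 3) (u 0 (i + 1) * v 0 (i + 2) - u 0 (i + 2) * v 0 (i + 1)).

Definition energy (R : realType) (q p : 'rV[R]_3) : R :=
  enorm p ^+ 2 / 2 - (enorm q)^-1.

(* The length of the Laplace-Runge-Lenz vector p x (q x p) - q / |q|. *)
Definition eccentricity (R : realType) (q p : 'rV[R]_3) : R :=
  enorm (cross p (cross q p) - (enorm q)^-1 *: q).

(* Solutions are considered on an open time interval J containing 0, not
   necessarily maximal; J = setT is the case of orbits defined for all time. *)
Definition kepler_orbit (R : realType) (J : set R) (q p : R -> 'rV[R]_3) :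
    Prop :=
  [/\ open J, is_interval J, J 0 &
      forall t : R, J t ->
        [/\ q t != 0,
            is_derive t (1 : R) q (p t) &
            is_derive t (1 : R) p (- ((enorm (q t) ^+ 3)^-1 *: q t))]].

Definition periapsis_at_0 (R : realType) (J : set R) (q : R -> 'rV[R]_3) :
    Prop :=
  forall t : R, J t -> enorm (q 0) <= enorm (q t).

(* The map S_+; a vector (x_0, x) of R x R^3 is the row vector row_mx x_0 x. *)
Definition S_plus (R : realType) (q p : 'rV[R]_3) :
    'rV[R]_(1 + 3) * 'rV[R]_(1 + 3) * R :=
  let w := Num.sqrt (2 * energy q p) in
  let r0 := enorm p ^+ 2 * enorm q - 1 in
  let rbar := - ((w * enorm q) *: p) in
  let s0 := - (w * dot q p) in
  let sbar := - ((enorm q)^-1 *: q - dot q p *: p) in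
  (row_mx (r0%:M : 'rV[R]_1) rbar, row_mx (s0%:M : 'rV[R]_1) sbar, w).

Definition hyperbolic_mean_anomaly (R : realType) (e : R) (psi : R -> R) :
    R -> R :=
  fun t => e * sinh (psi t) - psi t.

(* The hyperbolic anomaly of an orbit with position q, energy h > 0 and
   eccentricity e; a is the absolute value of its semi-major axis.  The equation
   for |q| fixes psi up to sign and the equation for the mean anomaly fixes
   the sign. *)
Definition hyperbolic_anomaly (R : realType) (J : set R) (h e : R)
    (q : R -> 'rV[R]_3) (psi : R -> R) : Prop :=
  let a := (2 * h)^-1 in
  [/\ {within J, continuous psi},
      psi 0 = 0,
      forall t : R, J t -> enorm (q t) = a * (e * cosh (psi t) - 1) &
      forall t : R, J t ->
        hyperbolic_mean_anomaly e psi t = a `^ (- (3 / 2)) * t].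

(* Main.v *)
(** With w = sqrt(2H) and theta' = - w / |q|, conservation of energy turns
    Kepler's equations into r' = theta' s and s' = theta' r, so that
    (r + s) exp(- theta) and (r - s) exp theta are constant: this is the
    hyperbolic rotation.  At periapsis <q, p> = 0, hence s_0 vanishes and
    r_0 = e there, and the 0-th coordinate of the rotation reads
    w^2 |q| = e cosh theta - 1.  Consequently e sinh theta - theta has
    derivative - w^3, i.e. - theta solves Kepler's equation
    e sinh x - x = w^3 t, whose solution x is unique when e > 1. *)

Require Import Defs.
From HB Require Import structures.
From mathcomp Require Import all_boot all_order all_algebra.
From mathcomp Require Import all_classical all_reals all_analysis.
From mathcomp Require Import ring lra.

Set Implicit Arguments.
Unset Strict Implicit.
Unset Printing Implicit Defensive.

Import Order.TTheory GRing.Theory Num.Theory.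
Import numFieldNormedType.Exports.

Local Open Scope classical_set_scope.
Local Open Scope ring_scope.

(** * Euclidean geometry of row vectors *)

(** Starting the cyclic sum at an arbitrary [i] matches the indexing of [cross], so identities for
    cross products can be checked at all coordinates at once. *)
Lemma dotE3 (R : realType) (u v : 'rV[R]_3) (i : 'I_3) :
  dot u v =
  u 0 i * v 0 i + u 0 (i + 1) * v 0 (i + 1) + u 0 (i + 2) * v 0 (i + 2).
Proof.
rewrite /dot (bigD1 i) //= (bigD1 (i + 1)) /=; last first.
  by case: i => [[|[|[|//]]] ?].
rewrite (bigD1 (i + 2)) /=; last by case: i => [[|[|[|//]]] ?].
rewrite big1 ?addr0 ?addrA // => j.
by case: i => [[|[|[|//]]] ?]; case: j => [[|[|[|//]]] ?].
Qed.

Lemma dotC (R : realType) (n : nat) (u v : 'rV[R]_n) : dot u v = dot v u.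
Proof. by apply: eq_bigr => i _; rewrite mulrC. Qed.

Lemma dotZr (R : realType) (n : nat) (c : R) (u v : 'rV[R]_n) :
  dot u (c *: v) = c * dot u v.
Proof.
by rewrite /dot mulr_sumr; apply: eq_bigr => i _; rewrite mxE mulrCA.
Qed.

Lemma dotNr (R : realType) (n : nat) (u v : 'rV[R]_n) :
  dot u (- v) = - dot u v.
Proof. by rewrite -scaleN1r dotZr mulN1r. Qed.

Lemma dot_ge0 (R : realType) (n : nat) (u : 'rV[R]_n) : 0 <= dot u u.
Proof. by apply: sumr_ge0 => i _; exact: sqr_ge0. Qed.

Lemma dot_gt0 (R : realType) (n : nat) (u : 'rV[R]_n) :
  u != 0 -> 0 < dot u u.
Proof.
move=> u0; rewrite lt_def dot_ge0 andbT; apply: contra u0.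
rewrite psumr_eq0 => [/allP u0|i _]; last exact: sqr_ge0.
apply/eqP/rowP => i; rewrite mxE; apply/eqP.
by have := u0 i (mem_index_enum i); rewrite mulf_eq0 orbb.
Qed.

Lemma enorm_sqr (R : realType) (n : nat) (u : 'rV[R]_n) :
  enorm u ^+ 2 = dot u u.
Proof. exact/sqr_sqrtr/dot_ge0. Qed.

Lemma enorm_gt0 (R : realType) (n : nat) (u : 'rV[R]_n) :
  u != 0 -> 0 < enorm u.
Proof. by move=> u0; rewrite sqrtr_gt0 dot_gt0. Qed.

Lemma enormZ (R : realType) (n : nat) (c : R) (u : 'rV[R]_n) :
  enorm (c *: u) = `|c| * enorm u.
Proof.
by rewrite /enorm dotZr dotC dotZr mulrA sqrtrM ?sqr_ge0 // sqrtr_sqr.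
Qed.

Lemma cross_cross (R : realType) (u v w : 'rV[R]_3) :
  cross u (cross v w) = dot u w *: v - dot u v *: w.
Proof.
apply/rowP => i.
have [E1 E2 E3 E4] : [/\ i + 1 + 1 = i + 2, i + 1 + 2 = i, i + 2 + 1 = i
    & i + 2 + 2 = i + 1].
  by split; apply/val_inj; case: i => [[|[|[|//]]] ?].
rewrite (dotE3 u w i) (dotE3 u v i) !mxE E1 E2 E3 E4.
ring.
Qed.

(** * Differentiation along curves *)

Lemma is_derive_coord (R : realType) (n : nat) (u : R -> 'rV[R]_n) (t : R)
    (du : 'rV[R]_n) (i : 'I_n) :
  is_derive t (1 : R) u du ->
  is_derive t (1 : R) (fun x => u x 0 i) (du 0 i).
Proof.
move=> Du; have du' := @ex_derive _ _ _ _ _ _ _ Du.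
apply: DeriveDef; first by move/derivable_mxP: du'.
have <- := @derive_val _ _ _ _ _ _ _ Du.
by rewrite derive_mx // mxE.
Qed.

Lemma is_derive_dot (R : realType) (n : nat) (u v : R -> 'rV[R]_n) (t : R)
    (du dv : 'rV[R]_n) :
  is_derive t (1 : R) u du -> is_derive t (1 : R) v dv ->
  is_derive t (1 : R) (fun x => dot (u x) (v x))
    (dot (u t) dv + dot du (v t)).
Proof.
move=> Du Dv.
have -> : (fun x => dot (u x) (v x)) =
    \sum_(i < n) ((fun x => u x 0 i) * (fun x => v x 0 i)).
  by apply/funext => x; rewrite fct_sumE.
apply: is_derive_eq.
  apply: is_derive_sum => i.
  by apply: is_deriveM; apply: is_derive_coord.
rewrite /dot -big_split; apply: eq_bigr => i _ /=.
by congr (_ + _); rewrite [LHS]mulrC.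
Qed.

Lemma is_derive_enorm (R : realType) (n : nat) (u : R -> 'rV[R]_n) (t : R)
    (du : 'rV[R]_n) :
  u t != 0 -> is_derive t (1 : R) u du ->
  is_derive t (1 : R) (fun x => enorm (u x)) (dot (u t) du / enorm (u t)).
Proof.
move=> u0 Du.
have D := is_derive_dot Du Du.
have n0 := enorm_gt0 u0.
have := @is_derive1_comp _ _ (fun x => dot (u x) (u x)) _ _ _
  (is_derive1_sqrt (dot_gt0 u0)) D.
move=> H; apply: (is_derive_eq H).
by rewrite (dotC du) /enorm; field; rewrite gt_eqF.
Qed.

(** By the mean value theorem on the segment between the two points, which stays in [J] because [J]
    is an interval. *)
Lemma is_derive0_interval_cst (R : realType) (J : set R) (f : R -> R)
    (a b : R) :
  is_interval J -> J a -> J b ->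
  (forall t, J t -> is_derive t (1 : R) f 0) -> f a = f b.
Proof.
move=> iJ; wlog ab : a b / a <= b => [wl Ja Jb Df|Ja Jb Df].
  have [ab|/ltW ba] := leP a b; first exact: wl.
  by apply/esym; exact: wl.
have abJ x : x \in `[a, b] -> J x.
  by rewrite in_itv /= => /iJ; exact.
have cf : {within `[a, b], continuous f}.
  apply: derivable_within_continuous => x /abJ Jx.
  by have Dx := Df x Jx; exact: ex_derive.
have Df' x : x \in `]a, b[ -> is_derive x (1 : R) f ((fun=> 0) x).
  by move=> /subset_itv_oo_cc/abJ; exact: Df.
have [c _] := MVT_segment ab Df' cf.
by rewrite mul0r => /eqP; rewrite subr_eq0 => /eqP.
Qed.

(** * Hyperbolic functions, Kepler's equation and hyperbolic rotations *)

Lemma cosh_ge1 (R : realType) (x : R) : 1 <= cosh x.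
Proof.
have x0 := expR_gt0 x.
rewrite /cosh expRN -subr_ge0.
have -> : (expR x + (expR x)^-1) / 2 - 1 = (expR x - 1) ^+ 2 / (2 * expR x).
  by field; rewrite gt_eqF.
by rewrite divr_ge0 ?sqr_ge0 // mulr_ge0 // ltW.
Qed.

Lemma sinh0 (R : realType) : sinh (0 : R) = 0.
Proof. by rewrite /sinh oppr0 subrr mul0r. Qed.

Lemma sinhN (R : realType) (x : R) : sinh (- x) = - sinh x.
Proof. by rewrite /sinh opprK -mulNr opprB. Qed.

Lemma is_derive_sinh (R : realType) (x : R) :
  is_derive x (1 : R) (@sinh R) (cosh x).
Proof.
have -> : @sinh R = 2^-1 \*: (expR - (expR \o -%R)).
  by apply/funext => y; exact: mulrC.
have D : is_derive x (1 : R) (expR \o -%R) (expR (- x) * - 1).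
  exact: is_derive1_comp.
apply: (is_derive_eq (is_deriveZ 2^-1 (is_deriveB (is_derive_expR x) D))).
rewrite /cosh mulrN1 opprK; exact: mulrC.
Qed.

(** The derivative [e * cosh x - 1] is positive, since [e > 1] and [cosh x >= 1]; hence the function
    increases strictly. *)
Lemma kepler_equation_inj (R : realType) (e : R) :
  1 < e -> injective (fun x : R => e * sinh x - x).
Proof.
move=> e1 x y; wlog : x y / x < y => [wl|xy E].
  by have [xy|yx|//] := ltgtP x y; [apply: wl|move=> E; apply/esym/wl].
pose f := e \*: @sinh R - id.
have Df z : is_derive z (1 : R) f (e * cosh z - 1).
  exact: is_deriveB (is_deriveZ e (is_derive_sinh z)) (is_derive_id z 1).
have cf : {within `[x, y], continuous f}.
  by apply: derivable_within_continuous => z _; exact: ex_derive.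
have [c _ Ec] := MVT xy (fun z _ => Df z) cf.
have : 0 < f y - f x.
  rewrite Ec mulr_gt0 ?subr_gt0 //.
  by rewrite (lt_le_trans e1) // ler_peMr ?cosh_ge1 // ltW // (lt_trans ltr01).
by rewrite subr_gt0 -[f y]/(e * sinh y - y) -E ltxx.
Qed.

Lemma hyperbolic_rotation (R : realType) (J : set R)
    (theta dtheta x y : R -> R) :
  is_interval J -> J 0 -> theta 0 = 0 ->
  (forall t, J t -> is_derive t (1 : R) theta (dtheta t)) ->
  (forall t, J t -> is_derive t (1 : R) x (dtheta t * y t)) ->
  (forall t, J t -> is_derive t (1 : R) y (dtheta t * x t)) ->
  forall t, J t ->
    x t = cosh (theta t) * x 0 + sinh (theta t) * y 0 /\
    y t = sinh (theta t) * x 0 + cosh (theta t) * y 0.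
Proof.
move=> iJ J0 th0 Dth Dx Dy t Jt.
have Dexp s : J s -> is_derive s (1 : R) (expR \o theta)
    (expR (theta s) * dtheta s).
  by move=> Js; apply: is_derive1_comp; exact: Dth.
have DexpN s : J s -> is_derive s (1 : R) (expR \o (- theta))
    (expR (- theta s) * - dtheta s).
  by move=> Js; apply: is_derive1_comp; apply: is_deriveN; exact: Dth.
have Eplus : (x t + y t) * expR (- theta t) = (x 0 + y 0) * expR (- theta 0).
  apply: (@is_derive0_interval_cst _ J ((x + y) * (expR \o (- theta))) t 0)
    => // s Js.
  apply: (is_derive_eq
    (is_deriveM (is_deriveD (Dx s Js) (Dy s Js)) (DexpN s Js))).
  rewrite !fctE /GRing.scale /=; ring.
have Eminus : (x t - y t) * expR (theta t) = (x 0 - y 0) * expR (theta 0).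
  apply: (@is_derive0_interval_cst _ J ((x - y) * (expR \o theta)) t 0)
    => // s Js.
  apply: (is_derive_eq
    (is_deriveM (is_deriveB (Dx s Js) (Dy s Js)) (Dexp s Js))).
  rewrite !fctE /GRing.scale /=; ring.
have E0 := expR_gt0 (theta t).
rewrite /cosh /sinh; move: Eplus Eminus.
rewrite th0 oppr0 expR0 !mulr1 expRN => Eplus Eminus.
(* Solving for the initial values, not the current ones, leaves two rational identities in
   [expR (theta t)]. *)
have Ex0 : x 0 =
    ((x t + y t) / expR (theta t) + (x t - y t) * expR (theta t)) / 2.
  by rewrite Eplus Eminus; field.
have Ey0 : y 0 =
    ((x t + y t) / expR (theta t) - (x t - y t) * expR (theta t)) / 2.
  by rewrite Eplus Eminus; field.
by rewrite Ex0 Ey0; split; field; rewrite gt_eqF.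
Qed.

(** * Energy and the components of [S_plus] along the Kepler flow *)

Lemma energyE (R : realType) (q p : 'rV[R]_3) :
  q != 0 -> 2 * energy q p = dot p p - 2 / enorm q.
Proof.
move=> /enorm_gt0 n0; rewrite /energy enorm_sqr; field.
by rewrite gt_eqF.
Qed.

(** The kinetic term contributes [- <q, p> / |q|^3] and the potential term the opposite. *)
Lemma is_derive_energy (R : realType) (q p : R -> 'rV[R]_3) (t : R) :
  q t != 0 ->
  is_derive t (1 : R) q (p t) ->
  is_derive t (1 : R) p (- ((enorm (q t) ^+ 3)^-1 *: q t)) ->
  is_derive t (1 : R) (fun x => energy (q x) (p x)) 0.
Proof.
move=> q0 Dq Dp; have n0 := enorm_gt0 q0.
have n00 : enorm (q t) != 0 by rewrite gt_eqF.
have -> : (fun x => energy (q x) (p x)) =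
    2^-1 \*: (fun x => dot (p x) (p x)) - (fun x => (enorm (q x))^-1).
  apply/funext => x; rewrite /energy enorm_sqr; congr (_ - _).
  exact: mulrC.
apply: (is_derive_eq (is_deriveB (is_deriveZ _ (is_derive_dot Dp Dp))
  (@is_deriveV _ (fun x => enorm (q x)) _ _ _ n00 (is_derive_enorm q0 Dq)))).
rewrite !(dotC _ (p t)) !(dotNr, dotZr) (dotC (p t)) /GRing.scale /=.
by field.
Qed.

Lemma energy_conserved (R : realType) (J : set R) (q p : R -> 'rV[R]_3)
    (t : R) :
  kepler_orbit J q p -> J t -> energy (q t) (p t) = energy (q 0) (p 0).
Proof.
move=> [_ iJ J0 Horb] Jt.
apply: (@is_derive0_interval_cst _ J (fun x => energy (q x) (p x))) => // s Js.
by have [q0 Dq Dp] := Horb s Js; exact: is_derive_energy.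
Qed.

(** Here [w] is a constant tied to the energy at the single time [t]; conservation of energy later
    supplies one [w] for all times, so the square root in [S_plus] is never differentiated. Vector
    parts are split into coordinates to fit the scalar system of [hyperbolic_rotation]. *)
Lemma is_derive_S_plus (R : realType) (q p : R -> 'rV[R]_3) (t w : R) :
  q t != 0 ->
  is_derive t (1 : R) q (p t) ->
  is_derive t (1 : R) p (- ((enorm (q t) ^+ 3)^-1 *: q t)) ->
  w ^+ 2 = 2 * energy (q t) (p t) ->
  [/\ is_derive t (1 : R) (fun x => enorm (p x) ^+ 2 * enorm (q x) - 1)
        (- (w / enorm (q t)) * - (w * dot (q t) (p t))),
      is_derive t (1 : R) (fun x => - (w * dot (q x) (p x)))
        (- (w / enorm (q t)) * (enorm (p t) ^+ 2 * enorm (q t) - 1)),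
      forall i, is_derive t (1 : R)
        (fun x => (- ((w * enorm (q x)) *: p x)) 0 i)
        (- (w / enorm (q t)) *
         (- ((enorm (q t))^-1 *: q t - dot (q t) (p t) *: p t)) 0 i) &
      forall i, is_derive t (1 : R)
        (fun x => (- ((enorm (q x))^-1 *: q x - dot (q x) (p x) *: p x)) 0 i)
        (- (w / enorm (q t)) * (- ((w * enorm (q t)) *: p t)) 0 i)].
Proof.
move=> q0 Dq Dp; rewrite energyE // => Ew; have n0 := enorm_gt0 q0.
have n00 : enorm (q t) != 0 by rewrite gt_eqF.
have Dn := is_derive_enorm q0 Dq.
have Dd := is_derive_dot Dq Dp.
(* The energy relation eliminates [|p|^2]; with it the derivative of [<q, p>], namely
   [|p|^2 - 1 / |q|], becomes [w^2 + 1 / |q|]. *)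
have Epp : dot (p t) (p t) = w ^+ 2 + 2 / enorm (q t) by rewrite Ew subrK.
have Eqq := enorm_sqr (q t).
have Ddot : dot (q t) (- ((enorm (q t) ^+ 3)^-1 *: q t)) + dot (p t) (p t) =
    w ^+ 2 + (enorm (q t))^-1.
  by rewrite dotNr dotZr -Eqq Epp; field.
split=> [||i|i].
- have -> : (fun x => enorm (p x) ^+ 2 * enorm (q x) - 1) =
      (fun x => dot (p x) (p x)) * (fun x => enorm (q x)) - cst 1.
    by apply/funext => x; rewrite enorm_sqr.
  apply: (is_derive_eq (is_deriveB (is_deriveM (is_derive_dot Dp Dp) Dn)
    (is_derive_cst (1 : R) t (1 : R)))).
  rewrite !(dotC _ (p t)) !(dotNr, dotZr) (dotC (p t) (q t)) Epp.
  by rewrite /GRing.scale /=; field.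
- apply: (is_derive_eq (is_deriveN (is_deriveZ w Dd))).
  by rewrite Ddot enorm_sqr Epp /GRing.scale /=; field.
- have -> : (fun x => (- ((w * enorm (q x)) *: p x)) 0 i) =
      - ((w \*: (fun x => enorm (q x))) * (fun x => p x 0 i)).
    by apply/funext => x; rewrite !mxE.
  apply: (is_derive_eq
    (is_deriveN (is_deriveM (is_deriveZ w Dn) (is_derive_coord i Dp)))).
  by rewrite !mxE /GRing.scale /= /GRing.scale /=; field.
- have -> : (fun x =>
        (- ((enorm (q x))^-1 *: q x - dot (q x) (p x) *: p x)) 0 i) =
      - ((fun x => (enorm (q x))^-1) * (fun x => q x 0 i)
         - (fun x => dot (q x) (p x)) * (fun x => p x 0 i)).
    by apply/funext => x; rewrite !mxE.
  apply: (is_derive_eq (is_deriveN (is_deriveB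
    (is_deriveM (@is_deriveV _ (fun x => enorm (q x)) _ _ _ n00 Dn)
      (is_derive_coord i Dq))
    (is_deriveM Dd (is_derive_coord i Dp))))).
  by rewrite Ddot !mxE /GRing.scale /=; field.
Qed.

(** * Periapsis, eccentricity and mean motion *)

(** As [J] is open, 0 is an interior minimum of [|q|], so the derivative [<q, p> / |q|] vanishes
    there. *)
Lemma periapsis_dot_eq0 (R : realType) (J : set R) (q p : R -> 'rV[R]_3) :
  kepler_orbit J q p -> periapsis_at_0 J q -> dot (q 0) (p 0) = 0.
Proof.
move=> [oJ iJ J0 Horb] Hperi.
have [d /= d0 dJ] : nbhs_ball (0 : R) J.
  by rewrite nbhs_ballE; exact: open_nbhs_nbhs.
have itvJ x : x \in `]- d, d[ -> J x.
  rewrite in_itv /= => xd; apply: dJ.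
  by rewrite /ball /= sub0r normrN ltr_norml.
have [q0 Dq _] := Horb 0 J0.
have Dn := is_derive_enorm q0 Dq.
have D0 : is_derive (0 : R) (1 : R) (fun x => enorm (q x)) 0.
  apply: (@derive1_at_min _ _ (- d) d).
  - by rewrite ltW // gt0_cp.
  - move=> x /itvJ/Horb[qx Dqx _].
    by have := is_derive_enorm qx Dqx => Dx; exact: ex_derive.
  - by rewrite in_itv /= oppr_lt0 d0.
  - by move=> x /itvJ; exact: Hperi.
have : dot (q 0) (p 0) / enorm (q 0) = 0.
  by rewrite -(@derive_val _ _ _ _ _ _ _ Dn) (@derive_val _ _ _ _ _ _ _ D0).
by move/eqP; rewrite mulf_eq0 invr_eq0 (gt_eqF (enorm_gt0 q0)) orbF => /eqP.
Qed.

Lemma eccentricity_dot_eq0 (R : realType) (q p : 'rV[R]_3) :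
  q != 0 -> 0 < energy q p -> dot q p = 0 ->
  eccentricity q p = enorm p ^+ 2 * enorm q - 1.
Proof.
move=> q0 h0 d0; have n0 := enorm_gt0 q0.
have := energyE p q0.
rewrite /eccentricity cross_cross (dotC p q) d0 scale0r subr0 -scalerBl enormZ.
move=> E; rewrite ger0_norm ?enorm_sqr; first by field; rewrite gt_eqF.
have : 0 < (enorm q)^-1 by rewrite invr_gt0.
lra.
Qed.

(** For [w^2 = 2H] the base is the semi-major axis [|a|], so this is the mean motion
    [|a|^(-3/2)]. *)
Lemma powR_invX_Nhalf3 (R : realType) (w : R) :
  0 < w -> ((w ^+ 2)^-1) `^ (- (3 / 2)) = w ^+ 3.
Proof.
move=> w0; rewrite -!powR_mulrn ?ltW // -powRN -powRrM.
by congr (_ `^ _); field.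
Qed.

(** * Rotation of the orbit and identification of the angle *)

Theorem proposition5p9 (R : realType) (J : set R) (q p : R -> 'rV[R]_3)
    (h e : R) (theta : R -> R)
    (Horbit : kepler_orbit J q p)
    (Henergy : energy (q 0) (p 0) = h) (h_gt0 : 0 < h)
    (Hecc : eccentricity (q 0) (p 0) = e) (e_gt1 : 1 < e)
    (Hperi : periapsis_at_0 J q)
    (theta0 : theta 0 = 0)
    (Hdtheta : forall t : R, J t ->
      is_derive t (1 : R) theta (- (Num.sqrt (2 * h) / enorm (q t)))) :
  let r := fun t : R => (S_plus (q t) (p t)).1.1 in
  let s := fun t : R => (S_plus (q t) (p t)).1.2 in
  (forall t : R, J t ->
     r t = cosh (theta t) *: r 0 + sinh (theta t) *: s 0 /\
     s t = sinh (theta t) *: r 0 + cosh (theta t) *: s 0) /\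
  (forall psi : R -> R, hyperbolic_anomaly J h e q psi ->
     forall t : R, J t -> theta t = - psi t).
Proof.
move=> r s; have [_ iJ J0 Horb] := Horbit.
set w := Num.sqrt (2 * h) in Hdtheta *.
have w0 : 0 < w by rewrite sqrtr_gt0 mulr_gt0.
have Ew : w ^+ 2 = 2 * h by rewrite sqr_sqrtr // mulr_ge0 // ltW.
have Hh t : J t -> energy (q t) (p t) = h.
  by move=> Jt; rewrite (energy_conserved Horbit Jt).
have HD t (Jt : J t) : w ^+ 2 = 2 * energy (q t) (p t) by rewrite Hh.
have DS t (Jt : J t) := let: And3 q0 Dq Dp := Horb t Jt in
  is_derive_S_plus q0 Dq Dp (HD t Jt).
pose r0 x := enorm (p x) ^+ 2 * enorm (q x) - 1.
pose s0 x := - (w * dot (q x) (p x)).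
have S0 t : J t -> r0 t = cosh (theta t) * r0 0 + sinh (theta t) * s0 0 /\
    s0 t = sinh (theta t) * r0 0 + cosh (theta t) * s0 0.
  by apply: hyperbolic_rotation iJ J0 theta0 Hdtheta _ _ t => t /DS[].
split=> [t Jt|psi [_ _ _ HM] t Jt].
  (* Conservation of energy replaces the square roots at times [t] and 0 by the same [w]; the row
     vectors then split into a scalar block, settled by [S0], and a spatial block, settled
     coordinatewise by [SV]. *)
  rewrite /r /s /S_plus /= !Hh // -/w -!/(r0 _) -!/(s0 _).
  rewrite !scale_row_mx !add_row_mx !scale_scalar_mx -!raddfD /=.
  have [<- <-] := S0 t Jt.
  have SV i := @hyperbolic_rotation _ _ _ _
    (fun x => (- ((w * enorm (q x)) *: p x)) 0 i)
    (fun x => (- ((enorm (q x))^-1 *: q x - dot (q x) (p x) *: p x)) 0 i)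
    iJ J0 theta0 Hdtheta
    (fun x Jx => let: And4 _ _ D _ := DS x Jx in D i)
    (fun x Jx => let: And4 _ _ _ D := DS x Jx in D i) t Jt.
  by split; congr row_mx; apply/rowP => i; have [E1 E2] := SV i;
    [rewrite E1|rewrite E2]; rewrite !mxE.
have [q0 _ _] := Horb 0 J0.
have d0 := periapsis_dot_eq0 Horbit Hperi.
have Ee : e = r0 0 by rewrite -Hecc eccentricity_dot_eq0 ?Hh.
(* Since [s0 0 = 0] and [r0 0 = e], the rotation gives [r0 x = e * cosh (theta x)], while the energy
   relation gives [r0 x = w^2 |q| + 1]. *)
have En x : J x -> w ^+ 2 * enorm (q x) = e * cosh (theta x) - 1.
  move=> Jx; have [qx _ _] := Horb x Jx; have := (S0 x Jx).1.
  rewrite -Ee /s0 d0 mulr0 oppr0 mulr0 addr0 mulrC => <-.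
  rewrite /r0 (HD x Jx) energyE // enorm_sqr.
  by field; rewrite gt_eqF ?enorm_gt0.
have EM : e * sinh (theta t) - theta t = - (w ^+ 3 * t).
  (* By [En], [(e * cosh theta - 1) * theta'] is [w^2 |q| * (- w / |q|) = - w^3], so the added term
     [w^3 t] makes [f] constant. *)
  pose f := e \*: (@sinh R \o theta) - theta + w ^+ 3 \*: id.
  have : f t = f 0.
    apply: (is_derive0_interval_cst iJ Jt J0) => x Jx.
    have Dth := Hdtheta x Jx.
    apply: (is_derive_eq (is_deriveD (is_deriveB
      (is_deriveZ e (is_derive1_comp (is_derive_sinh (theta x)) Dth)) Dth)
      (is_deriveZ (w ^+ 3) (is_derive_id x (1 : R))))).
    have [qx _ _] := Horb x Jx.
    have -> : cosh (theta x) = (w ^+ 2 * enorm (q x) + 1) / e.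
      by rewrite En //; field; rewrite gt_eqF // (lt_trans ltr01).
    rewrite /GRing.scale /=; field.
    by rewrite !gt_eqF ?enorm_gt0 // (lt_trans ltr01).
  rewrite /f !fctE /= theta0 sinh0 !scaler0 subr0 addr0.
  by move/eqP; rewrite addr_eq0 => /eqP.
(* Kepler's function is odd, so its value at [theta t] is minus its value [w^3 t] at [psi t], that
   is, its value at [- psi t]. *)
apply: (kepler_equation_inj e_gt1); rewrite /= EM sinhN opprK mulrN.
have := HM t Jt; rewrite /hyperbolic_mean_anomaly -Ew powR_invX_Nhalf3 // => <-.
by rewrite opprB addrC.
Qed.
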